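(* For every integer $r>2$ there is an integer $N(r)$ such that every $2$-connected graph of order at least $N(r)$ contains, as an induced subgraph, a graph isomorphic to one of the following: the complete graph $K_r$; a clean ladder of order at least $r$; a member of the family $\mathscr{K}_{2,r}$; a member of the family $\mathscr{K}_{2,r}^+$.
   Context: All graphs are finite, simple and undirected. The order of a graph is its number of vertices. For an integer $r>2$, $\mathscr{K}_{2,r}$ is the family of graphs obtained from the complete bipartite graph $K_{2,r}$ by subdividing each of its edges an arbitrary number, possibly zero, of times (different edges may be subdivided different numbers of times). $\mathscr{K}_{2,r}^+$ is the family of graphs obtained by adding, to each member of $\mathscr{K}_{2,r}$, an edge between the two vertices of degree $r$. A messy ladder is a triple $(L,X,Y)$ consisting of a graph $L$ whose vertices all lie on two disjoint induced paths $X$ and $Y$ of $L$, called rails. Each rail is rooted at one of its endpoints, called its initial vertex; the other endpoint is called its terminal vertex. The graph $L$ has an edge $\sigma$ between the initial vertices of the two rails and an edge $\tau$ between the terminal vertices of the two rails. At most one of the rails may be trivial (a single vertex, which is then both initial and terminal). Edges of $L$ belonging to neither $X$ nor $Y$ are called rungs. The order of the messy ladder is the number of vertices of $L$. The graph $L$ itself is also called a messy ladder when such $X$ and $Y$ exist. On each rail write $u\le v$ if $u$ lies on the sub-path of the rail from its initial vertex to $v$, and $u<v$ if in addition $u\ne v$; for $a\le b$ on a rail, say $X$, $X[a,b]$ is the sub-path induced by the vertices $v$ with $a\le v\le b$. For a rung $e$, $e_X$ and $e_Y$ denote its endpoints on $X$ and $Y$. An ordered pair $(e,f)$ of rungs is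 a cross if $e_X<f_X$ and $f_Y<e_Y$; its $X$-span is $X[e_X,f_X]$ and its $Y$-span is $Y[f_Y,e_Y]$. A cross is degenerate if its $X$-span and its $Y$-span are both single edges. A clean ladder is a messy ladder all of whose crosses are degenerate. *)

(* Defs.v *)
From HB Require Import structures.
From mathcomp Require Import all_boot.

Set Implicit Arguments.
Unset Strict Implicit.
Unset Printing Implicit Defensive.

Record sgraph := SGraph {
  vertex :> finType;
  adj : rel vertex;
  adj_sym : symmetric adj;
  adj_irrefl : irreflexive adj }.

Definition graph_order (G : sgraph) : nat := #|G|.

Definition isomorphic (G H : sgraph) : Prop :=
  exists f : G -> H, bijective f /\ {mono f : x y / adj x y}.

Section Induced.
Variables (G : sgraph) (S : {set G}).

Definition induced_adj : rel {x : G | x \in S} :=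
  fun x y => adj (val x) (val y).

Fact induced_adj_sym : symmetric induced_adj.
Proof. by move=> x y; apply: adj_sym. Qed.

Fact induced_adj_irrefl : irreflexive induced_adj.
Proof. by move=> x; apply: adj_irrefl. Qed.

Definition induced : sgraph := SGraph induced_adj_sym induced_adj_irrefl.
End Induced.

Definition has_induced (G H : sgraph) : Prop :=
  exists S : {set G}, isomorphic (induced S) H.

Definition connected (G : sgraph) : Prop :=
  0 < graph_order G /\ forall x y : G, connect (@adj G) x y.

Definition two_connected (G : sgraph) : Prop :=
  [/\ 2 < graph_order G, connected G & forall v : G, connected (induced [set~ v])].

Section Complete.
Variable r : nat.

Definition complete_adj : rel 'I_r := fun x y => x != y.

Fact complete_adj_sym : symmetric complete_adj.
Proof. by move=> x y; rewrite /complete_adj eq_sym. Qed.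

Fact complete_adj_irrefl : irreflexive complete_adj.
Proof. by move=> x; rewrite /complete_adj eqxx. Qed.

Definition complete : sgraph := SGraph complete_adj_sym complete_adj_irrefl.
End Complete.

Section AddEdge.
Variables (G : sgraph) (u v : G).

(* The conjunct [x != y] only matters in the degenerate case [u = v]. *)
Definition add_edge_adj : rel G := fun x y =>
  adj x y || (x != y) && ([set x; y] == [set u; v]).

Fact add_edge_adj_sym : symmetric add_edge_adj.
Proof. by move=> x y; rewrite /add_edge_adj adj_sym eq_sym setUC. Qed.

Fact add_edge_adj_irrefl : irreflexive add_edge_adj.
Proof. by move=> x; rewrite /add_edge_adj adj_irrefl eqxx. Qed.

Definition add_edge : sgraph := SGraph add_edge_adj_sym add_edge_adj_irrefl.
End AddEdge.

Section SubdividedK2.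
Variables (r : nat) (l : 'I_2 * 'I_r -> nat).

(* The edge p = (i, j) of K_{2,r} is subdivided l p times: it becomes the path
     i, (p, 0), ..., (p, l p - 1), j.
   The vertices are those of K_{2,r}, in ['I_2 + 'I_r], and the subdividing
   vertices (p, k) with k < l p. *)
Definition K2_vertex : finType :=
  ('I_2 + 'I_r + {p : 'I_2 * 'I_r & 'I_(l p)})%type.

Definition K2_hub (i : 'I_2) : K2_vertex := inl (inl i).

Definition K2_arc : rel K2_vertex := fun x y =>
  match x, y with
  | inl (inl i), inl (inr j) => l (i, j) == 0
  | inl (inl i), inr (existT p k) => (p.1 == i) && (val k == 0)
  | inr (existT p k), inr (existT q m) => (p == q) && ((val k).+1 == val m)
  | inr (existT p k), inl (inr j) => (p.2 == j) && ((val k).+1 == l p)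
  | _, _ => false
  end.

Definition K2_adj : rel K2_vertex := fun x y => K2_arc x y || K2_arc y x.

Fact K2_adj_sym : symmetric K2_adj.
Proof. by move=> x y; rewrite /K2_adj orbC. Qed.

Fact K2_adj_irrefl : irreflexive K2_adj.
Proof.
rewrite /K2_adj; case=> [[i|j]|[p k]] //=.
by rewrite orbb gtn_eqF ?andbF.
Qed.

Definition K2_subdivision : sgraph := SGraph K2_adj_sym K2_adj_irrefl.

(* For r > 2 the two hubs are the only vertices of degree r. *)
Definition K2_plus_subdivision : sgraph :=
  @add_edge K2_subdivision (K2_hub ord0) (K2_hub ord_max).
End SubdividedK2.

Definition family_K2 (r : nat) (H : sgraph) : Prop :=
  exists l : 'I_2 * 'I_r -> nat, isomorphic H (K2_subdivision l).

Definition family_K2_plus (r : nat) (H : sgraph) : Prop :=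
  exists l : 'I_2 * 'I_r -> nat, isomorphic H (K2_plus_subdivision l).

Section Ladders.
Variable L : sgraph.
Implicit Types X Y s : seq L.

(* A rail is the sequence of its vertices, listed from the initial vertex to
   the terminal vertex. *)
Definition induced_path s : Prop :=
  [/\ s != [::], uniq s &
   {in s &, forall u v, adj u v =
      ((index u s).+1 == index v s) || ((index v s).+1 == index u s)}].

Definition ends_joined X Y : bool :=
  match X, Y with
  | x :: X', y :: Y' => adj x y && adj (last x X') (last y Y')
  | _, _ => false
  end.

Definition messy_ladder X Y : Prop :=
  [/\ induced_path X /\ induced_path Y,
      [disjoint X & Y],
      forall v : L, (v \in X) || (v \in Y),
      ends_joined X Y
    & (1 < size X) || (1 < size Y)].

(* The rails of a messy ladder are induced, disjoint and cover L, so an edge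
   that lies on neither rail joins them; it is given as the pair (x, y) of its
   endpoints on X and on Y. *)
Definition rung X Y (e : L * L) : bool :=
  [&& e.1 \in X, e.2 \in Y & adj e.1 e.2].

Definition rail_le s (u v : L) : bool := index u s <= index v s.

Definition rail_lt s (u v : L) : bool := rail_le s u v && (u != v).

Definition rail_span s (a b : L) : seq L :=
  [seq v <- s | rail_le s a v && rail_le s v b].

Definition single_edge s : bool := size s == 2.

Definition cross X Y (e f : L * L) : bool :=
  [&& rung X Y e, rung X Y f, rail_lt X e.1 f.1 & rail_lt Y f.2 e.2].

Definition degenerate X Y (e f : L * L) : bool :=
  single_edge (rail_span X e.1 f.1) && single_edge (rail_span Y f.2 e.2).

Definition clean_ladder_on X Y : Prop :=
  messy_ladder X Y /\ forall e f, cross X Y e f -> degenerate X Y e f.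
End Ladders.

Definition clean_ladder (L : sgraph) : Prop :=
  exists X Y : seq L, clean_ladder_on X Y.

(* Main.v *)
(* If a vertex [v] has huge degree, grow a breadth-first tree of [G - v] from a
   neighbour of [v]. Either some other neighbour of [v] is far away, and a
   shortest path to it together with [v] is a ladder with a trivial rail; or
   some vertex [w] has many children in the subtree spanned by the neighbours of
   [v], which gives many disjoint short paths from [w], each ending at its first
   neighbour of [v]. By Ramsey's theorem the adjacency pattern between two
   of these paths may be assumed constant. A diagonal entry of the pattern yields
   [K_r], an off-diagonal one an induced [K_{2,r}], and the empty pattern a
   subdivision of [K_{2,r}] with hubs [v] and [w], plus the edge [vw] if [v] and
   [w] are adjacent.

   If all degrees are bounded, there are two vertices [x], [y] far apart. Take two
   internally disjoint paths [P], [Q] between them with minimal total length: a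
   chord, or the exchange of tails along a nondegenerate cross, would give a
   shorter pair, so [P] and the interior of [Q] are the rails of a clean ladder. *)
Require Import Defs.
From HB Require Import structures.
From mathcomp Require Import all_boot zify.
From Stdlib Require Import Classical_Prop.

Set Implicit Arguments.
Unset Strict Implicit.
Unset Printing Implicit Defensive.

(** * Induced copies of the target graphs *)

Lemma has_induced_embedding (G H : sgraph) (f : H -> G) :
  injective f -> {mono f : x y / adj x y} -> has_induced G H.
Proof.
move=> f_inj f_mono; pose S := [set f x | x in H]; exists S.
pose h (x : H) : induced S := exist _ (f x) (imset_f f (isT : x \in predT)).
have h_inj : injective h by move=> x y /(congr1 val) /f_inj.
have [|g hK gK] := inj_card_bij h_inj; first by rewrite card_sig card_imset.
exists g; split; first by exists h.
by move=> x y; rewrite -f_mono -[in RHS](gK x) -[in RHS](gK y).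
Qed.

Lemma isomorphic_refl (G : sgraph) : isomorphic G G.
Proof. by exists id; split=> //; exists id. Qed.

Section Theta.
Variables (G : sgraph) (r : nat) (v w : G) (l : 'I_r -> nat).
(** [P i 0], ..., [P i (l i)] are the inner vertices of the [i]-th of [r] paths from [v] to [w]; the
    bound [a <= l i] makes sure that there is at least one. *)
Variable P : 'I_r -> nat -> G.
Hypothesis v_neq_w : v != w.
Hypothesis P_inj : forall i j a b, a <= l i -> b <= l j ->
  P i a = P j b -> i = j /\ a = b.
Hypothesis adj_P : forall i j a b, a <= l i -> b <= l j ->
  adj (P i a) (P j b) = (i == j) && ((a.+1 == b) || (b.+1 == a)).
Hypothesis v_notin : forall j a, a <= l j -> P j a != v.
Hypothesis w_notin : forall j a, a <= l j -> P j a != w.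
Hypothesis adj_v : forall j a, a <= l j -> adj v (P j a) = (a == 0).
Hypothesis adj_w : forall j a, a <= l j -> adj w (P j a) = (a == l j).

(* The whole path [P j] is read off the subdivided edge at hub [0]; the edges
   at hub [1] are not subdivided. *)
Let len (p : 'I_2 * 'I_r) := if p.1 == ord0 then l p.2 else 0.

Let f (x : K2_vertex len) : G :=
  match x with
  | inl (inl i) => if i == ord0 then v else w
  | inl (inr j) => P j (l j)
  | inr (existT p k) => P p.2 k
  end.

Let len_ord (p : 'I_2 * 'I_r) (k : 'I_(len p)) : p.1 = ord0 /\ k < l p.2.
Proof. by case: p k => i j [k] /=; rewrite /len /=; case: eqP. Qed.

Let hubP (i : 'I_2) : i = ord0 \/ i = ord_max.
Proof. by case: i => [[|[|]]] // ?; [left|right]; apply: val_inj. Qed.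

Let f_inj : injective f.
Proof.
move=> [[i|j]|[p k]] [[i'|j']|[p' k']] /=.
- case: (hubP i) (hubP i') => -> [] -> //= /eqP; first by rewrite (negPf v_neq_w).
  by rewrite eq_sym (negPf v_neq_w).
- by case: (hubP i) => -> /= /esym/eqP; rewrite ?(negPf (v_notin (leqnn _))) ?(negPf (w_notin (leqnn _))).
- have [_ /ltnW lt] := len_ord k'.
  by case: (hubP i) => -> /= /esym/eqP; rewrite ?(negPf (v_notin lt)) ?(negPf (w_notin lt)).
- by case: (hubP i') => -> /= /eqP; rewrite ?(negPf (v_notin (leqnn _))) ?(negPf (w_notin (leqnn _))).
- by move=> /(P_inj (leqnn _) (leqnn _)) [->].
- have [_ lt] := len_ord k'.
  by move=> /(P_inj (leqnn _) (ltnW lt)) [? E]; subst; rewrite E ltnn in lt.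
- have [_ /ltnW lt] := len_ord k.
  by case: (hubP i') => -> /= /eqP; rewrite ?(negPf (v_notin lt)) ?(negPf (w_notin lt)).
- have [_ lt] := len_ord k.
  by move=> /(P_inj (ltnW lt) (leqnn _)) [? E]; subst; rewrite E ltnn in lt.
have [E lt] := len_ord k; have [E' lt'] := len_ord k'.
case: p p' k k' E E' lt lt' => i j [i' j'] k k' /= E E' lt lt'; subst.
by move=> /(P_inj (ltnW lt) (ltnW lt')) [? E]; subst; rewrite (val_inj E).
Qed.

(** The possible edge between [v] and [w] is kept apart from [K2_adj], so that one computation
    serves both families. *)
Let adj_f x y : adj (f x) (f y) = K2_adj x y || 
   match x, y with inl (inl i), inl (inl i') => (i != i') && adj v w | _, _ => false end.
Proof.
rewrite /K2_adj.
case: x => [[i|j]|[p k]]; case: y => [[i'|j']|[p' k']] /=; rewrite ?orbF.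
- by case: (hubP i) (hubP i') => -> [] -> //=; rewrite ?adj_irrefl ?[adj w v]adj_sym.
- case: (hubP i) => -> /=; rewrite ?adj_v ?adj_w // eq_sym /len //=; lia.
- have [E] := len_ord k'; move: (nat_of_ord k') => {}k' lt.
  case: (hubP i) => -> /=; rewrite E ?adj_v ?adj_w ?(ltnW lt) //=; lia.
- rewrite adj_sym; case: (hubP i') => -> /=; rewrite ?adj_v ?adj_w // eq_sym /len //=; lia.
- rewrite adj_P //; case: eqP => [->|] //=; lia.
- have [E] := len_ord k'; move: (nat_of_ord k') => {}k' lt.
  rewrite adj_P ?(ltnW lt) // [p'.2 == j]eq_sym /len E eqxx; case: eqP => [->|] //=; lia.
- have [E] := len_ord k; move: (nat_of_ord k) => {}k lt; rewrite adj_sym.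
  case: (hubP i') => -> /=; rewrite E ?adj_v ?adj_w ?(ltnW lt) //=; lia.
- have [E] := len_ord k; move: (nat_of_ord k) => {}k lt.
  by rewrite adj_P ?(ltnW lt) // /len E eqxx; move: lt; case: eqP => [->|] //=; lia.
have [E lt] := len_ord k; have [E' lt'] := len_ord k'.
rewrite adj_P ?(ltnW lt) ?(ltnW lt') //.
have eqE (a b : 'I_2 * 'I_r) : (a == b) = (a.1 == b.1) && (a.2 == b.2) by case: a b => ? ? [].
by rewrite !eqE E E' eqxx /= [p'.2 == _]eq_sym andb_orr.
Qed.

Lemma theta_has_induced :
  exists H, has_induced G H /\ (family_K2 r H \/ family_K2_plus r H).
Proof.
case vw : (adj v w); last first.
  exists (K2_subdivision len); split; last first.
    by left; exists len; apply: isomorphic_refl.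
  apply: (@has_induced_embedding _ (K2_subdivision len) f f_inj) => x y; rewrite adj_f vw.
  by case: x y => [[?|?]|[? ?]] [[?|?]|[? ?]]; rewrite ?andbF orbF.
exists (K2_plus_subdivision len); split; last first.
  by right; exists len; apply: isomorphic_refl.
apply: (@has_induced_embedding _ (K2_plus_subdivision len) f f_inj) => x y.
rewrite adj_f vw /= /add_edge_adj /=; congr (_ || _).
have hubs z x' y' : [set x'; y'] == [set K2_hub len ord0; K2_hub len ord_max] ->
    z \in [set x'; y'] -> exists i, z = K2_hub len i.
  by move=> /eqP->; rewrite !inE => /orP[] /eqP->; eexists.
case: (boolP (_ == [set K2_hub _ _; _])) => [xy|nxy]; last first.
  rewrite andbF; case: x y nxy => [[i|?]|[? ?]] [[i'|?]|[? ?]] //.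
  case: (hubP i) (hubP i') => -> [] -> //=; rewrite ?eqxx //.
  by rewrite setUC eqxx.
have [|i ->] := hubs x _ _ xy; first by rewrite !inE eqxx.
have [|i' ->] := hubs y _ _ xy; first by rewrite !inE eqxx orbT.
by rewrite andbT; case: (hubP i) (hubP i') => -> [] ->.
Qed.
End Theta.

(** * Transfer of ladders along embeddings *)

Section LadderEmbedding.
Variables (G H : sgraph) (f : H -> G).
Hypotheses (f_inj : injective f) (f_mono : {mono f : x y / adj x y}).
Implicit Types (X Y s : seq H).

Lemma induced_path_map s : induced_path (map f s) <-> induced_path s.
Proof.
split=> [] [s0 su sP]; split; rewrite ?map_inj_uniq // in su *; try by case: s {sP su} s0.
  by move=> u v us vs; rewrite -f_mono sP ?map_f // !index_map.
by move=> _ _ /mapP[u us ->] /mapP[v vs ->]; rewrite f_mono sP // !index_map.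
Qed.

Lemma rail_lt_map s u v : rail_lt (map f s) (f u) (f v) = rail_lt s u v.
Proof. by rewrite /rail_lt /rail_le !index_map // (inj_eq f_inj). Qed.

Lemma rail_span_map s u v : rail_span (map f s) (f u) (f v) = map f (rail_span s u v).
Proof.
rewrite /rail_span filter_map; congr map.
by apply: eq_filter => x /=; rewrite /rail_le !index_map.
Qed.

(** Rails are built as sequences in [G], but the definition wants them to cover the whole graph.
    Rungs, crosses and spans depend only on indices and adjacency, which [f] preserves, so they can
    be pulled back to [H]. *)
Lemma clean_ladder_on_map X Y :
  induced_path (map f X) -> induced_path (map f Y) -> [disjoint map f X & map f Y] ->
  ends_joined (map f X) (map f Y) -> (1 < size X) || (1 < size Y) ->
  (forall e e', cross (map f X) (map f Y) e e' -> degenerate (map f X) (map f Y) e e') ->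
  (forall v, (v \in X) || (v \in Y)) ->
  clean_ladder_on X Y.
Proof.
move=> /induced_path_map Xi /induced_path_map Yi dXY ends sz clean cover.
split; first split=> //.
- apply/pred0P => x /=; apply: contraTF dXY => /andP[xX xY].
  by apply/pred0Pn; exists (f x); rewrite /= !map_f.
- by case: X Y ends {Xi Yi dXY sz clean cover} => [|x X] [|y Y] //=; rewrite !last_map !f_mono.
move=> e e' /and4P[/and3P[e1 e2 ae] /and3P[e'1 e'2 ae'] lt1 lt2].
have := clean (f e.1, f e.2) (f e'.1, f e'.2).
rewrite /cross /rung /= !mem_map // e1 e2 e'1 e'2 !f_mono ae ae' !rail_lt_map lt1 lt2.
by rewrite /degenerate /single_edge /= !rail_span_map !size_map => /(_ isT).
Qed.
End LadderEmbedding.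

Lemma ladder_has_induced (G : sgraph) (X Y : seq G) :
  induced_path X -> induced_path Y -> [disjoint X & Y] -> ends_joined X Y ->
  (1 < size X) || (1 < size Y) ->
  (forall e f, cross X Y e f -> degenerate X Y e f) ->
  exists H, [/\ has_induced G H, clean_ladder H & graph_order H = size X + size Y].
Proof.
move=> Xi Yi dXY ends sz clean; pose S := [set x in X ++ Y].
have lift (s : seq G) : {subset s <= S} -> exists s' : seq (induced S), map val s' = s.
  elim: s => [|x s IH] sS; first by exists [::].
  have [|s' <-] := IH; first by move=> y ys; rewrite sS // inE ys orbT.
  by exists (exist _ x (sS x (mem_head _ _)) :: s').
have [|X' XE] := lift X; first by move=> x xX; rewrite inE mem_cat xX.
have [|Y' YE] := lift Y; first by move=> x xY; rewrite inE mem_cat xY orbT.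
exists (induced S); split.
- by exists S; apply: isomorphic_refl.
- exists X', Y'; apply: (@clean_ladder_on_map G (induced S) val val_inj (fun _ _ => erefl)); rewrite ?XE ?YE //.
    by rewrite -XE -YE !size_map in sz.
  move=> v; rewrite -(mem_map val_inj X') -(mem_map val_inj Y') XE YE.
  by have := valP v; rewrite inE mem_cat.
rewrite /graph_order /= card_sig -size_cat -(card_uniqP _).
  by apply: eq_card => x; rewrite !inE.
case: Xi Yi => _ Xu _ [_ Yu _]; rewrite cat_uniq Xu Yu andbT /=.
by rewrite disjoint_sym disjoint_has in dXY.
Qed.

Lemma induced_path_nth (G : sgraph) (x0 : G) (s : seq G) : s != [::] -> uniq s ->
  (forall i j, i < j < size s -> adj (nth x0 s i) (nth x0 s j) = (i.+1 == j)) ->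
  induced_path s.
Proof.
move=> s0 su sP; split=> // u v us vs.
have {1}<- := nth_index x0 us; have {1}<- := nth_index x0 vs.
have : index u s < size s by rewrite index_mem.
have : index v s < size s by rewrite index_mem.
move: (index u s) (index v s) => i j ltj lti.
case: (ltngtP i j) => [ij|ji|->]; last by rewrite adj_irrefl; lia.
  by rewrite sP ?ij //; lia.
by rewrite adj_sym sP ?ji //; lia.
Qed.

(** * Two disjoint paths between two vertices *)

(** Descent on [f]. It is classical because [P] is any proposition on a possibly infinite type, such
    as pairs of sequences. *)
Lemma exists_minimizer (T : Type) (P : T -> Prop) (f : T -> nat) :
  (exists x, P x) -> exists2 x, P x & forall y, P y -> f x <= f y.
Proof.
case=> x; have [n] := ubnP (f x); elim: n x => // n IH x ltn Px.
have [[y [Py lty]]|nex] := classic (exists y, P y /\ f y < f x).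
  by apply: (IH y) => //; apply: leq_trans lty _.
exists x => // y Py; rewrite leqNgt; apply/negP => lty.
by apply: nex; exists y.
Qed.

Lemma take_drop_disjoint (T : eqType) (s : seq T) i j z : uniq s -> i <= j ->
  z \in take i s -> z \in drop j s -> False.
Proof.
move=> us leij /index_ltn lti /(nthP z)[k]; rewrite size_drop nth_drop => ltk zE.
by move: lti; rewrite -zE index_uniq //; lia.
Qed.

Section Walks.
Variables (T : eqType) (e : rel T).
Implicit Types (x y z : T) (P Q : seq T).

Definition splice P i Q j := take i.+1 P ++ drop j Q.

Lemma size_splice P i Q j : i < size P -> size (splice P i Q j) = i.+1 + (size Q - j).
Proof. by move=> ltiP; rewrite size_cat size_takel // size_drop. Qed.

Lemma nth_splice x P i Q j k : i < size P ->
  nth x (splice P i Q j) k = if k <= i then nth x P k else nth x Q (j + (k - i.+1)).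
Proof.
by move=> ltiP; rewrite nth_cat size_takel // nth_drop ltnS; case: leqP => // ?; rewrite nth_take.
Qed.

(** Both ends are listed; [ohead] also excludes the empty list, where [last] would return its
    default. *)
Definition upath x y P := [/\ sorted e P, uniq P, ohead P = Some x & last x P = y].

Lemma upath_mem x y P : upath x y P -> x \in P /\ y \in P.
Proof. by case: P => [|z P] [] //= _ _ [->] <-; rewrite mem_head mem_last. Qed.

Lemma upath_size x y P : upath x y P -> 0 < size P.
Proof. by case: P => [|z P] []. Qed.

Lemma upath_head x y P z : upath x y P -> nth z P 0 = x.
Proof. by case: P => [|t P] [] //= _ _ []. Qed.

Lemma upath_last x y P z : upath x y P -> nth z P (size P).-1 = y.
Proof.
move=> Pp; case: Pp (upath_size Pp) => _ _ _ <- P0.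
by rewrite -(nth_last x) (set_nth_default x) // ltn_predL.
Qed.

(** When [j] is [size Q] the tail is empty and the path must already stop at index [i] of [P];
    otherwise an edge bridges the two pieces. *)
Lemma upath_splice x y x' y' P i Q j : upath x x' P -> upath y' y Q ->
  i < size P -> j <= size Q ->
  (if j == size Q then nth x P i = y else e (nth x P i) (nth x Q j)) ->
  (forall z, z \in take i.+1 P -> z \in drop j Q -> False) ->
  upath x y (splice P i Q j).
Proof.
move=> Pp Qp ltiP lejQ link dis; have [sP uP _ _] := Pp; have [sQ uQ _ _] := Qp.
split.
- apply/(sortedP x) => k; rewrite size_splice // => ltk; rewrite !nth_splice //.
  case: ltngtP => ki.
  + by apply: (sortedP x sP); lia.
  + by rewrite subSn // addnS; apply: (sortedP x sQ); lia.
  by rewrite ki subnn addn0; rewrite ifF in link; [|lia].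
- rewrite cat_uniq take_uniq // drop_uniq // andbT /=.
  by apply/hasPn => z zQ; apply/negP => zP; apply: (dis z).
- by move: Pp ltiP => [_ _]; case: (P).
rewrite -nth_last size_splice //= nth_splice //.
case: eqP link => [-> <-|jQ _]; first by rewrite subnn addn0 leqnn.
rewrite ifF; last lia.
by rewrite -(upath_last x Qp); congr nth; lia.
Qed.

Lemma upath_shortcut x y P i j : upath x y P -> i.+1 < j < size P ->
  e (nth x P i) (nth x P j) -> upath x y (splice P i P j).
Proof.
move=> Pp /andP[ltij ltj] eij; apply: (upath_splice Pp Pp); rewrite ?ifF //; try lia.
by have [_ uP _ _] := Pp => z; apply: take_drop_disjoint; rewrite // ltnW.
Qed.

Definition path_pair x y P Q :=
  [/\ upath x y P, upath x y Q & forall z, z \in P -> z \in Q -> z = x \/ z = y].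

Lemma path_pairC x y P Q : path_pair x y P Q -> path_pair x y Q P.
Proof. by case=> Pp Qp dis; split=> // z zQ zP; apply: dis. Qed.

(** Whitney's induction step. If [z], the last vertex of [R] on either path, lies on [P], then
    follow [P] to [z] and [R] from there; the other path is [Q] followed by the edge [u v]. *)
Lemma path_pair_extend x u v P Q R k : v != x -> v != u -> e u v ->
  path_pair x u P Q -> upath x v R -> u \notin R -> k < size R ->
  nth x R k \in P -> (forall z, z \in drop k.+1 R -> (z \notin P) && (z \notin Q)) ->
  exists P' Q', path_pair x v P' Q'.
Proof.
move=> vx vu euv [Pp Qp dis] Rp uR ltkR; set z := nth x R k => zP zmax.
have zu : z != u by apply: contraNneq uR => <-; apply: mem_nth.
have [_ uP _ _] := Pp; have vR : nth x R (size R).-1 = v := upath_last x Rp.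
(* Either [v] comes after [z] on [R], hence off both paths, or [v = z] is on [P], and being neither
   [x] nor [u] it cannot also be on [Q]. *)
have vQ : v \notin Q.
  have [le|gt] := leqP (size R) k.+1; last first.
    have v_drop : v \in drop k.+1 R.
      rewrite -vR; apply/(nthP x); exists ((size R).-1 - k.+1); rewrite ?size_drop ?nth_drop; last congr nth; lia.
    by have /andP[] := zmax v v_drop.
  have vz : v = z by rewrite -vR /z; congr nth; lia.
  by apply/negP; rewrite vz => /(dis _ zP) [] /eqP; rewrite -vz ?(negPf vx) ?(negPf vu).
exists (splice P (index z P) R k.+1), (rcons Q v); split.
- apply: (upath_splice Pp Rp); rewrite ?index_mem ?nth_index //.
    case: eqP => [kR|kR]; first by rewrite -vR /z; congr nth; lia.
    by case: Rp => sR _ _ _; apply: (sortedP x sR); lia.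
  by move=> t /mem_take tP /zmax; rewrite tP.
- case: Qp vQ {dis zmax} => sQ; case: Q sQ => [|q Q] //= sQ uQ [<-] uE vQ.
  split=> //; last by rewrite /= last_rcons.
    by rewrite /= rcons_path sQ uE.
  by rewrite -rcons_cons rcons_uniq vQ.
move=> t; rewrite mem_cat mem_rcons inE => tP /orP[/eqP|tQ]; first by right.
have {}tP : t \in take (index z P).+1 P.
  by case/orP: tP => // /zmax; rewrite tQ andbF.
(* The case [t = u] is impossible: [u] comes last on [P], so the part of [P] up to [z] would contain
   it only if [z = u]. *)
have [|tu] := dis t (mem_take tP) tQ; first by left.
have ltz : index z P < size P by rewrite index_mem.
have uI : index u P = (size P).-1.
  by rewrite -(upath_last x Pp) index_uniq //; lia.
have := index_ltn tP; rewrite tu uI => le.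
case/eqP: zu; rewrite -(nth_index x zP) -(upath_last x Pp); congr nth; lia.
Qed.

(** [R] starts at [x], which is on both paths, so it has a last vertex on their union; the roles of
    [P] and [Q] are symmetric. *)
Lemma path_pair_step x u v P Q R : v != x -> v != u -> e u v ->
  path_pair x u P Q -> upath x v R -> u \notin R ->
  exists P' Q', path_pair x v P' Q'.
Proof.
move=> vx vu euv PQ Rp uR.
pose on k := (nth x R k \in P) || (nth x R k \in Q).
have [Pp _ _] := PQ.
have ex_on : exists k, (k < size R) && on k.
  exists 0; rewrite (upath_size Rp) /on (upath_head x Rp).
  by have [-> _] := upath_mem Pp.
have bnd k : (k < size R) && on k -> k <= size R by case/andP => /ltnW.
case: (ex_maxnP ex_on bnd) => k /andP[ltk onk] kmax.
have zmax z : z \in drop k.+1 R -> (z \notin P) && (z \notin Q).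
  case/(nthP x) => i; rewrite size_drop nth_drop => lti zE.
  rewrite -negb_or; apply: contraTN isT => zPQ.
  have := kmax (k.+1 + i); rewrite /on zE zPQ andbT; lia.
case/orP: onk => [zP|zQ].
  exact: path_pair_extend PQ Rp uR ltk zP zmax.
apply: (path_pair_extend vx vu euv (path_pairC PQ) Rp uR ltk zQ).
by move=> z /zmax; rewrite andbC.
Qed.
End Walks.

Lemma connect_upath (T : finType) (e : rel T) x y :
  connect e x y -> exists P, upath e x y P.
Proof.
case/connectP => p pth ->; case/shortenP: pth => p' pth up _.
by exists (x :: p').
Qed.

(** Induction along a walk from [x] to [y]: with [u] the vertex before the last, [R] comes from the
    connectedness of [G - u]. *)
Lemma two_connected_path_pair (G : sgraph) (x y : G) : two_connected G -> x != y ->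
  exists P Q, path_pair (@adj G) x y P Q.
Proof.
case=> _ [_ conn] conn1 xy; have [p] := connectP (conn x y).
elim/last_ind: p y xy => [|p v IH] y xy; first by move=> _ yx; rewrite yx eqxx in xy.
rewrite rcons_path last_rcons => /andP[pth uv] yE; subst y.
set u := last x p in uv IH.
have vx : v != x by rewrite eq_sym.
have vu : v != u by apply: contraTneq uv => ->; rewrite adj_irrefl.
have [xu|xu] := eqVneq x u.
  (* For an edge, both paths may be that same edge: it has no inner vertices to share. *)
  exists [:: x; v], [:: x; v]; split=> [||z]; last by rewrite !inE => /orP[]/eqP; auto.
    by split; rewrite /= ?andbT ?inE // {1}xu.
  by split; rewrite /= ?andbT ?inE // {1}xu.
have [P [Q PQ]] := IH u xu pth erefl.
have xS : x \in [set~ u] by rewrite !inE.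
have vS : v \in [set~ u] by rewrite !inE.
have [_ /(_ (exist _ x xS) (exist _ v vS)) /connect_upath [R [sR uR hR lR]]] := conn1 u.
apply: (@path_pair_step _ _ x u v P Q (map val R) vx vu uv PQ).
  split.
  - by rewrite sorted_map.
  - by rewrite map_inj_uniq //; apply: val_inj.
  - by case: (R) hR => [|a R'] //= [->].
  by rewrite -[x]/(val (exist _ x xS : {x : G | x \in [set~ u]})) last_map lR.
by apply/negP => /mapP[[w wS] _ /= uE]; move: wS; rewrite -uE !inE eqxx.
Qed.

(** * Shortest pairs of paths form clean ladders *)

Section ShortestPair.
Variables (T : eqType) (e : rel T).
Hypothesis e_sym : symmetric e.
Implicit Types (x y z : T) (P Q : seq T).

Lemma upath_head_drop x y P j : upath e x y P -> 0 < j -> x \notin drop j P.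
Proof.
move=> Pp j0; apply/negP; apply: (@take_drop_disjoint _ _ 1) => //; first by case: Pp.
by case: Pp => _ _; case: P => //= a P [->] _; rewrite take0 mem_head.
Qed.

Lemma upath_last_take x y P i : upath e x y P -> i.+1 < size P -> y \notin take i.+1 P.
Proof.
move=> Pp ltiP; apply/negP => yP.
apply: (@take_drop_disjoint _ P i.+1 (size P).-1 y) => //; [by case: Pp|lia|].
rewrite (drop_nth x); last by lia.
by rewrite (upath_last x Pp) mem_head.
Qed.

(** A chord would give a shortcut. Minimality is asked only among paths within the vertices of [P],
    because replacing [P] by such a path keeps it internally disjoint from [Q] in a pair. *)
Lemma shortest_upath_chord x y P i j : upath e x y P ->
  (forall P', upath e x y P' -> {subset P' <= P} -> size P <= size P') -> i < j < size P ->
  e (nth x P i) (nth x P j) = (i.+1 == j).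
Proof.
move=> Pp min /andP[ltij ltj]; have [sP _ _ _] := Pp.
case: eqP => [<-|ij]; first by apply: (sortedP x sP); lia.
have ltij' : i.+1 < j < size P by lia.
apply/negP => /(upath_shortcut Pp ltij')/min; rewrite size_splice; last by lia.
suff H : {subset splice P i P j <= P} by move=> /(_ H); lia.
by move=> z; rewrite mem_cat => /orP[/mem_take|/mem_drop].
Qed.

Definition shortest_pair x y P Q := path_pair e x y P Q /\
  forall P' Q', path_pair e x y P' Q' -> size P + size Q <= size P' + size Q'.

Lemma shortest_pairC x y P Q : shortest_pair x y P Q -> shortest_pair x y Q P.
Proof.
case=> PQ min; split; first exact: path_pairC.
by move=> P' Q' /path_pairC /min; rewrite ![_ + size P]addnC [size P' + _]addnC.
Qed.

Lemma shortest_pair_chord x y P Q i j : shortest_pair x y P Q -> i < j < size P ->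
  e (nth x P i) (nth x P j) = (i.+1 == j).
Proof.
move=> [[Pp Qp dis] min]; apply: (shortest_upath_chord Pp) => P' Pp' sub.
rewrite -(leq_add2r (size Q)); apply: min; split=> // z /sub.
exact: dis.
Qed.

(* Exchanging the tails of the two paths along a cross saves the two spans and
   costs the two rungs. *)
Lemma shortest_pair_cross x y P Q i i' j j' : shortest_pair x y P Q ->
  i < i' < size P -> j < j' < size Q ->
  e (nth x P i) (nth x Q j') -> e (nth x P i') (nth x Q j) -> i' = i.+1 /\ j' = j.+1.
Proof.
move=> [[Pp Qp dis] min] /andP[lti lti'] /andP[ltj ltj'] e1 e2.
have [_ uP _ _] := Pp; have [_ uQ _ _] := Qp.
have Pp' : upath e x y (splice P i Q j').
  apply: (upath_splice Pp Qp); rewrite ?ifF //; try lia.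
  move=> z zP zQ; have [zx|zy] := dis z (mem_take zP) (mem_drop zQ); subst z.
    by move: zQ; apply/negP/(upath_head_drop Qp); lia.
  by move: zP; apply/negP/(upath_last_take Pp); lia.
have Qp' : upath e x y (splice Q j P i').
  apply: (upath_splice Qp Pp); rewrite ?ifF //; try lia; first by rewrite e_sym.
  move=> z zQ zP; have [zx|zy] := dis z (mem_drop zP) (mem_take zQ); subst z.
    by move: zP; apply/negP/(upath_head_drop Pp); lia.
  by move: zQ; apply/negP/(upath_last_take Qp); lia.
have H z : z \in splice P i Q j' -> z \in splice Q j P i' -> z = x \/ z = y.
  rewrite !mem_cat => /orP[zP|zQ] /orP[zQ'|zP'].
  - exact: dis (mem_take zP) (mem_take zQ').
  - by case: (take_drop_disjoint uP lti zP zP').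
  - by case: (take_drop_disjoint uQ ltj zQ' zQ).
  - exact: dis (mem_drop zP') (mem_drop zQ).
(* Minimality gives [(i' - i) + (j' - j) <= 2], and both terms are positive. *)
have := min _ _ (And3 Pp' Qp' H); rewrite !size_splice; lia.
Qed.
End ShortestPair.

Lemma rail_span_edge (L : sgraph) (s : seq L) u v : uniq s -> v \in s ->
  index v s = (index u s).+1 -> single_edge (rail_span s u v).
Proof.
move=> us vs uv; have us' : u \in s by rewrite -index_mem; move: vs; rewrite -index_mem; lia.
suff /perm_size E : perm_eq (rail_span s u v) [:: u; v] by rewrite /single_edge E.
apply: uniq_perm; first exact: filter_uniq.
  by rewrite /= inE andbT; apply: contra_eqN uv => /eqP->; lia.
move=> z; rewrite mem_filter !inE /rail_le uv.
have [zs|zs] := boolP (z \in s); last first.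
  by rewrite andbF; apply/esym/negP => /orP[]/eqP zE; rewrite zE ?us' ?vs in zs.
have idx t : t \in s -> (z == t) = (index z s == index t s).
  by move=> ts; apply/eqP/eqP => [->//|]; apply: index_inj.
by rewrite !idx // uv andbT; lia.
Qed.

(** The rails are [P], ends included, and the interior [q] of [Q]; the first and last edges of [Q]
    join their ends. As [x] and [y] are distinct and not adjacent, [q] is not empty. The order is
    bounded through [P] alone. *)
Lemma far_pair_ladder (G : sgraph) (x y : G) n : two_connected G -> 1 < n ->
  (forall p, path (@adj G) x p -> last x p = y -> n <= size p) ->
  exists H, [/\ has_induced G H, clean_ladder H & n <= graph_order H].
Proof.
move=> G2 n1 far.
have xy : x != y by apply/eqP => /(far [::] isT) /=; lia.
have nxy : ~~ adj x y by apply/negP => axy; have := far [:: y]; rewrite /= axy => /(_ isT erefl) /=; lia.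
have [|[P Q] PQ min] := @exists_minimizer (seq G * seq G)
    (fun PQ => path_pair (@adj G) x y PQ.1 PQ.2) (fun PQ => size PQ.1 + size PQ.2).
  by have [P [Q PQ]] := two_connected_path_pair G2 xy; exists (P, Q).
have {min}PQ : shortest_pair (@adj G) x y P Q.
  by split=> // P' Q' ?; apply: (min (P', Q')).
have [[Pp Qp dis] _] := PQ.
have [q QE] : exists q, Q = x :: rcons q y.
  case: Qp {PQ dis}; case: Q => [|a Q] //= _ _ [->]; case/lastP: Q => [/eqP|q z].
    by rewrite (negPf xy).
  by rewrite last_rcons => ->; exists q.
have [sP uP hP lP] := Pp; have [sQ uQ _ _] := Qp.
have nthq i : i < size q -> nth x q i = nth x Q i.+1.
  by move=> lti; rewrite QE /= nth_rcons lti.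
have sizeQ : size Q = (size q).+2 by rewrite QE /= size_rcons.
have uq : uniq q by move: uQ; rewrite QE /= rcons_uniq => /and3P[].
have q0 : q != [::].
  apply: contraNneq nxy => q0; by move: sQ; rewrite QE q0 /= andbT.
have xq : x \notin q by move: uQ; rewrite QE /= mem_rcons inE negb_or => /andP[/andP[]].
have yq : y \notin q by move: uQ; rewrite QE /= rcons_uniq => /and3P[].
have Pi : induced_path P.
  apply: (@induced_path_nth _ x) => //; first by case: (P) hP.
  by move=> i j; apply: (shortest_pair_chord PQ).
have qi : induced_path q.
  apply: (@induced_path_nth _ x) => // i j ij.
  by rewrite !nthq ?(shortest_pair_chord (shortest_pairC PQ)) ?sizeQ //; lia.
have [||||H [GH cH oH]] := @ladder_has_induced G P q Pi qi.
- apply/pred0P => z /=; apply/negP => /andP[zP zq].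
  have [|zx|zy] := dis z zP; first by rewrite QE inE mem_rcons inE zq !orbT.
    by rewrite -zx zq in xq.
  by rewrite -zy zq in yq.
- have lq : adj (last x q) y && adj x (head x q).
    move: sQ; rewrite QE /= rcons_path => /andP[+ ->] /=.
    by case: (q) q0 => //= a q' _ /andP[].
  by case: (P) hP lP (q) q0 lq => //= a P' [->] -> [] //= b q' _ /andP[l1 ->]; rewrite adj_sym.
- have : 0 < size P by apply: upath_size Pp.
  have := far (behead P); case: (P) hP sP lP => //= a P' [->] aP lP' /(_ aP lP') /=; lia.
- move=> e f /and4P[/and3P[e1 e2 ae] /and3P[f1 f2 af] lt1 lt2].
  have idx (s : seq G) u v : u \in s -> v \in s -> rail_lt s u v -> index u s < index v s.
    rewrite /rail_lt /rail_le => us vs /andP[le]; apply: contraNT; rewrite -leqNgt => ge.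
    by apply/eqP/(index_inj u us vs)/eqP; rewrite eqn_leq le.
  have {}lt1 := idx _ _ _ e1 f1 lt1; have {}lt2 := idx _ _ _ f2 e2 lt2.
  have ltf : index f.1 P < size P by rewrite index_mem.
  have lte : index e.2 q < size q by rewrite index_mem.
  (* Dropping [x] from [Q] shifts indices by one, whence the successors on the side of [q]. *)
  have [||||E1 E2] := @shortest_pair_cross _ _ (@adj_sym G) x y P Q (index e.1 P) (index f.1 P)
    (index f.2 q).+1 (index e.2 q).+1 PQ.
  + by rewrite lt1.
  + by rewrite sizeQ ltnS lt2 /= ltnS ltnW.
  + by rewrite (nth_index x e1) -(nthq _ lte) (nth_index x e2).
  + by rewrite (nth_index x f1) -nthq ?index_mem // (nth_index x f2).
  by case: E2 => E2; rewrite /degenerate !rail_span_edge.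
exists H; split=> //; rewrite oH.
have := far (behead P); case: (P) hP sP lP => //= a P' [->] aP lP' /(_ aP lP') /=; lia.
Qed.

(** * Branching in breadth-first trees *)

(** [d] is the distance from [s], and [par x] is the vertex before [x] on some shortest walk from
    [s]. *)
Lemma bfs_tree (G : sgraph) (s : G) : connected G ->
  exists (d : G -> nat) (par : G -> G),
    [/\ forall x, (d x == 0) = (x == s),
        forall x y, adj x y -> d y <= (d x).+1,
        forall x, x != s -> adj x (par x)
      & forall x, d (par x) = (d x).-1].
Proof.
case=> _ conn.
pose reach x n := [exists p : n.-tuple G, path (@adj G) s p && (last s p == x)].
have reachP x n : reflect (exists p, [/\ path (@adj G) s p, last s p = x & size p = n]) (reach x n).
  apply: (iffP existsP) => [[p /andP[pth /eqP lp]]|[p [pth lp sp]]].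
    by exists p; rewrite size_tuple.
  by exists (Tuple (introT eqP sp)); rewrite /= pth lp eqxx.
have ex_reach x : exists n, reach x n.
  by have [p pth xE] := connectP (conn s x); exists (size p); apply/reachP; exists p.
pose d x := ex_minn (ex_reach x).
have d_le x p : path (@adj G) s p -> last s p = x -> d x <= size p.
  by move=> pth lp; rewrite /d; case: ex_minnP => n _; apply; apply/reachP; exists p.
have d0 x : (d x == 0) = (x == s).
  apply/eqP/eqP => [|->]; last by apply/eqP; rewrite -leqn0; apply: (d_le s [::]).
  by rewrite /d; case: ex_minnP => n /reachP[p [_ <- <-]] _ /eqP/nilP->.
have lip x y : adj x y -> d y <= (d x).+1.
  move=> xy; rewrite {2}/d; case: ex_minnP => n /reachP[p [pth lp <-]] _.
  by rewrite -(size_rcons p y); apply: d_le; rewrite ?last_rcons ?rcons_path ?pth ?lp.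
have up x : x != s -> exists y, adj x y && (d x == (d y).+1).
  move=> xs; have : reach x (d x) by rewrite /d; case: ex_minnP.
  case/reachP => p []; case/lastP: p => [|p z]; first by move=> _ /= xE; rewrite -xE eqxx in xs.
  rewrite rcons_path last_rcons size_rcons => /andP[pth lpz] zx dx; subst z.
  exists (last s p); rewrite adj_sym lpz /= eqn_leq lip //=.
  by rewrite -dx ltnS d_le.
(* The default makes the root its own parent, so that [d (par x) = (d x).-1] holds there too, by
   truncated subtraction. *)
exists d, (fun x => odflt s [pick y | adj x y && (d x == (d y).+1)]); split=> // x.
  by move=> /up[y]; case: pickP => [z /andP[]|/(_ y)->].
case: pickP => [z /andP[_ /eqP->]//|no] /=.
have [->|/up[y]] := eqVneq x s; last by rewrite no.
have /eqP -> : d s == 0 by rewrite d0.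
by [].
Qed.

Lemma card_bigcup_le (T : finType) (A : {set T}) (F : T -> {set T}) m :
  (forall x, x \in A -> #|F x| <= m) -> #|\bigcup_(x in A) F x| <= #|A| * m.
Proof.
move=> Fm; rewrite -sum_nat_const; apply: (@leq_trans (\sum_(x in A) #|F x|)); last exact: leq_sum.
elim/big_rec2: _ => [|x a b _ le]; first by rewrite cards0.
by rewrite (leq_trans (leq_card_setU _ _)) // leq_add2l.
Qed.

(** If [S] is the neighbourhood of a further vertex [v], this is the interior of a path from [v] to
    [w] with no chord except possibly [v w]. *)
Definition leg (G : sgraph) (w : G) (S : {set G}) (p : seq G) :=
  [/\ uniq p,
      forall i, i < size p -> (nth w p i \in S) = (i == 0),
      forall i, i < size p -> adj w (nth w p i) = (i.+1 == size p),
      w \notin p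
    & forall i j, i < size p -> j < size p ->
        adj (nth w p i) (nth w p j) = (i.+1 == j) || (j.+1 == i)].

(** If all of [S] has depth below [n] and each vertex has at most [m] children in the subtree
    spanned by [S], then level [i] has at most [m ^ i] vertices and [S] is too small. So some [w]
    has more than [m] children, each leading down to [S]. *)
Lemma bfs_star (G : sgraph) n m (S : {set G}) : connected G ->
  \sum_(i < n) m ^ i < #|S| ->
  (exists s t, [/\ s \in S, t \in S &
     forall p, path (@adj G) s p -> last s p = t -> n <= size p]) \/
  exists w (ps : seq (seq G)), [/\ m < size ps,
    {in ps, forall p, leg w S p /\ 0 < size p <= n} &
    pairwise (fun p q => [disjoint p & q]) ps].
Proof.
move=> conn ltS.
have [s sS] : exists s, s \in S by apply/set0Pn; rewrite -card_gt0; lia.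
have [d [par [d0 lip adj_par d_par]]] := bfs_tree s conn.
have [[t [tS dt]]|close] := classic (exists t, t \in S /\ n <= d t).
  left; exists s, t; split=> // p pth lp; apply: leq_trans dt _; rewrite -lp.
  have /eqP ds : d s == 0 by rewrite d0.
  have : d (last s p) <= d s + size p.
    elim: p {lp} s {sS d0 ds adj_par} pth => [|x p IH] s /=; first by rewrite addn0.
    by case/andP => sx /IH; have := lip _ _ sx; lia.
  by rewrite ds.
right.
have {}close t : t \in S -> d t < n.
  by move=> tS; rewrite ltnNge; apply/negP => le; apply: close; exists t.
have d_iter k x : d (iter k par x) = d x - k.
  by elim: k => [|k IH]; rewrite ?subn0 //= d_par IH subnS.
(* The vertices of [S] and all their ancestors. *)
pose A := [set x | [exists t in S, fconnect par t x]].
have AP x : reflect (exists2 t, t \in S & exists k, iter k par t = x) (x \in A).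
  rewrite inE; apply: (iffP exists_inP) => [[t tS /iter_findex <-]|[t tS [k <-]]].
    by exists t => //; eexists.
  by exists t => //; apply: fconnect_iter.
(* The root is excluded because it is its own parent. *)
pose children w := [set c in A | (par c == w) && (c != s)].
have [w ltw] : exists w, m < #|children w|.
  apply/existsP; apply: contraLR ltS => /existsPn small; rewrite -leqNgt.
  have {}small w : #|children w| <= m by rewrite leqNgt small.
  have level i : #|[set x in A | d x == i]| <= m ^ i.
    elim: i => [|i IH].
      rewrite expn0 -(cards1 s); apply/subset_leq_card/subsetP => x.
      by rewrite inE d0 => /andP[_]; rewrite inE.
    rewrite expnSr; apply: leq_trans (leq_mul IH (leqnn m)).
    apply: leq_trans (card_bigcup_le (F := children) (fun w _ => small w)).
    apply/subset_leq_card/subsetP => x; rewrite inE => /andP[xA /eqP dx].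
    apply/bigcupP; exists (par x); last first.
      by rewrite !inE eqxx -d0 dx andbT /=; rewrite inE in xA.
    rewrite inE d_par dx eqxx andbT; apply/AP.
    by have [t tS [k <-]] := AP _ xA; exists t => //; exists k.+1.
  have levels k : #|[set x in A | d x < k]| <= \sum_(i < k) m ^ i.
    elim: k => [|k IH].
      by rewrite big_ord0 leqn0 cards_eq0; apply/eqP/setP => x; rewrite !inE andbF.
    rewrite big_ord_recr /=; apply: leq_trans (leq_add IH (level k)).
    apply: leq_trans (leq_card_setU _ _).1; apply/subset_leq_card/subsetP => x.
    by rewrite !inE => /andP[->] /=; rewrite ltnS leq_eqVlt orbC.
  apply: leq_trans (levels n); apply/subset_leq_card/subsetP => x xS.
  by rewrite inE close // andbT; apply/AP; exists x => //; exists 0.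
(* The leg climbs from [t] in [S] to the child [c]. Taking the fewest steps keeps every later vertex
   out of [S]. *)
pose legs c p := exists t k, [/\ t \in S, iter k par t = c, p = traject par t k.+1 &
  forall i, 0 < i <= k -> iter i par t \notin S].
have [F FP] : exists F, forall c, c \in A -> legs c (F c).
  have : forall c, exists p, c \in A -> legs c p.
    move=> c; have [cA|] := boolP (c \in A); last by exists [::].
    have [|k [t [tS tk]] min] := @exists_minimizer nat
      (fun k => exists t, t \in S /\ iter k par t = c) id.
      by have [t tS [k tk]] := AP _ cA; exists k, t.
    exists (traject par t k.+1) => _; exists t, k; split=> // i /andP[i0 lei].
    apply/negP => iS; have := min (k - i); suff H : exists t', t' \in S /\ iter (k - i) par t' = c.
      by move=> /(_ H) /=; lia.
    by exists (iter i par t); rewrite -iterD subnK.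
  by move=> /fin_all_exists [F FP]; exists F.
exists w, (map F (enum (children w))); rewrite size_map -cardE; split=> //.
  move=> _ /mapP[c cE ->]; move: cE; rewrite mem_enum inE => /and3P[cA /eqP cw cs].
  have [t [k [tS tk -> kmin]]] := FP c cA.
  have dc : 0 < d c by rewrite lt0n d0.
  have dw : d w = (d c).-1 by rewrite -cw d_par.
  have dt : d c = d t - k by rewrite -tk d_iter.
  have nthE i : i < k.+1 -> nth w (traject par t k.+1) i = iter i par t.
    by move=> lti; rewrite (set_nth_default t) ?size_traject // nth_traject.
  have ns i : i <= k -> iter i par t != s by move=> lei; rewrite -d0 d_iter; lia.
  (* Depth drops by exactly one at each step of the leg, while the ends of an edge differ in depth
     by at most one; this excludes chords, and below also other neighbours of [w]. *)
  have adjE i j : i < j <= k -> adj (iter i par t) (iter j par t) = (i.+1 == j).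
    move=> /andP[ltij lej]; case: eqP => [<-|neq].
      by rewrite iterS adj_par // ns; lia.
    by apply/negP; rewrite adj_sym => /lip; rewrite !d_iter; lia.
  rewrite /leg size_traject; split; last by have := close t tS; lia.
  split.
  - apply/(uniqP t) => i j; rewrite !inE !size_traject => lti ltj.
    rewrite !nth_traject // => /(congr1 d); rewrite !d_iter; lia.
  - move=> i lti; rewrite nthE //; case: eqP => [->//|i0].
    by apply/negbTE/kmin; lia.
  - move=> i lti; rewrite nthE // eqSS; case: eqP => [->|ik].
      by rewrite tk adj_sym -cw adj_par.
    by apply/negP => /lip; rewrite d_iter; lia.
  - by apply/negP => /trajectP[i lti /(congr1 d)]; rewrite d_iter; lia.
  move=> i j lti ltj; rewrite !nthE //; case: (ltngtP i j) => [ij|ji|->].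
  - by rewrite adjE; lia.
  - by rewrite adj_sym adjE; lia.
  by rewrite adj_irrefl; lia.
rewrite pairwise_map; have := enum_uniq (children w); rewrite uniq_pairwise.
apply: (@sub_in_pairwise _ [in children w]); last first.
  by apply/allP => c; rewrite mem_enum.
move=> c c' /=; rewrite unfold_in inE => /and3P[cA /eqP cw cs].
rewrite unfold_in inE => /and3P[c'A /eqP c'w c's].
apply: contraNT => /pred0Pn[z /andP[]] /=.
have [t [k [tS tk -> _]]] := FP c cA; have [t' [k' [tS' tk' -> _]]] := FP c' c'A.
move=> /trajectP[i lti zi] /trajectP[j ltj zj].
(* A vertex [z] on both legs has [c] and [c'] as ancestors. As children of the same [w] they have
   equal depth, so they coincide. *)
have cz : c = iter (k - i) par z by rewrite zi -iterD subnK.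
have c'z : c' = iter (k' - j) par z by rewrite zj -iterD subnK.
have dcc' : (d c).-1 = (d c').-1 by rewrite -!d_par cw c'w.
have : 0 < d c by rewrite lt0n d0.
have : 0 < d c' by rewrite lt0n d0.
have : d c = d z - (k - i) by rewrite cz d_iter.
have : d c' = d z - (k' - j) by rewrite c'z d_iter.
move=> ? ? ? ?; have ij : k - i = k' - j by lia.
by rewrite cz c'z ij.
Qed.

(** * Ramsey's theorem and the two cases *)

Lemma pigeonhole_count (C : finType) (T : Type) (g : T -> C) (s : seq T) k :
  #|C| * k < size s -> exists c, k < count (fun x => g x == c) s.
Proof.
move=> lt; apply/existsP; apply: contraLR lt => /existsPn small; rewrite -leqNgt.
have -> : size s = \sum_(c : C) count (fun x => g x == c) s.
  elim: s {small} => [|x s IH] /=; first by rewrite big1.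
  by rewrite big_split /= -IH (bigD1 (g x)) //= eqxx big1 // => c; rewrite eq_sym => /negPf->.
rewrite -sum_nat_const; apply: leq_sum => c _.
by rewrite leqNgt small.
Qed.

(** First half of Ramsey's theorem: each element is recorded with the one colour it has towards all
    later ones. Keep the head, pass to a large colour class of the rest, and repeat. [col] need not
    be symmetric, as only pairs in list order count. *)
Lemma ramsey_end_homogeneous (C : finType) n : exists M, forall (T : eqType) (col : T -> T -> C)
    (s : seq T), M <= size s ->
  exists t : seq (T * C), [/\ subseq (map fst t) s, size t = n &
    pairwise (fun a b => col a.1 b.1 == a.2) t].
Proof.
elim: n => [|n [M IH]]; first by exists 0 => T col s _; exists [::]; rewrite sub0seq.
exists (#|C| * M).+2 => T col [//|a s]; rewrite /= ltnS => /pigeonhole_count - /(_ (col a)) [c].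
rewrite -size_filter => /ltnW /(IH _ col) [t [sub_t <- pt]].
exists ((a, c) :: t); split=> //=.
  by rewrite eqxx; apply: subseq_trans sub_t (filter_subseq _ _).
rewrite pt andbT; apply/allP => b bt.
have := mem_subseq sub_t (map_f fst bt).
by rewrite mem_filter => /andP[].
Qed.

(** Second half: elements recorded with equal colours are homogeneous, and the pigeonhole principle
    finds [k] of them. *)
Lemma ramsey (C : finType) k : exists M, forall (T : eqType) (col : T -> T -> C) (s : seq T),
  M <= size s ->
  exists c t, [/\ subseq t s, size t = k & pairwise (fun a b => col a b == c) t].
Proof.
have [M MP] := ramsey_end_homogeneous C (#|C| * k).+1.
exists M => T col s /(MP _ col) [t [sub_t size_t pt]].
have [|c] := @pigeonhole_count C _ snd t k; first by rewrite size_t.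
rewrite -size_filter => /ltnW ltk.
pose t' := take k [seq x <- t | x.2 == c].
have sub_t' : subseq t' t by apply: subseq_trans (take_subseq _ _) (filter_subseq _ _).
exists c, (map fst t'); rewrite size_map size_takel //; split=> //.
  by apply: subseq_trans sub_t; apply: map_subseq.
rewrite pairwise_map; apply: (@sub_in_pairwise _ [pred x | x.2 == c]) (subseq_pairwise sub_t' pt).
  by move=> a b /= /eqP <- _.
by apply/allP => x /mem_take; rewrite mem_filter => /andP[].
Qed.

Definition unavoidable (r : nat) (G : sgraph) :=
  exists H : sgraph, has_induced G H /\
      [\/ isomorphic H (complete r),
          clean_ladder H /\ r <= graph_order H,
          family_K2 r H
        | family_K2_plus r H].

Lemma unavoidable_theta r G :
  (exists H, has_induced G H /\ (family_K2 r H \/ family_K2_plus r H)) -> unavoidable r G.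
Proof. by case=> H [GH [HK|HK]]; exists H; split=> //; [apply: Or43|apply: Or44]. Qed.

(** A shortest path from [s] to [t] avoiding [v] is one rail and [v] alone is the other; a cross
    would need two distinct vertices on the latter. *)
Lemma fan_unavoidable r (G : sgraph) (v : G) (s t : induced [set~ v]) :
  connected (induced [set~ v]) -> adj v (val s) -> adj v (val t) ->
  (forall p, path (@adj (induced [set~ v])) s p -> last s p = t -> r <= size p) ->
  0 < r -> unavoidable r G.
Proof.
move=> [_ conn] vs vt far r0.
have [|X Xp min] := @exists_minimizer _ (upath (@adj (induced [set~ v])) s t) size.
  exact: connect_upath.
have [sX uX hX lX] := Xp.
have Xi : induced_path X.
  apply: (@induced_path_nth _ s) => //; first by case: (X) hX.
  by move=> i j; apply: (shortest_upath_chord Xp) => Y /min.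
have rX : r < size X.
  by have := far (behead X); case: (X) hX sX lX => //= a X' [->] aX lX' /(_ aX lX').
have [||||||H [GH cH oH]] := @ladder_has_induced G (map val X) [:: v].
- exact: (@induced_path_map G (induced [set~ v]) val val_inj (fun _ _ => erefl) X).2.
- by split=> // a b; rewrite !inE => /eqP-> /eqP->; rewrite adj_irrefl /= eqxx.
- rewrite disjoint_sym disjoint_has /= orbF; apply/mapP => [[[x xv] _ /= vx]].
  by move: xv; rewrite -vx !inE eqxx.
- by case: (X) hX lX => //= a X' [->]; rewrite last_map => ->; rewrite !(@adj_sym _ (val _)) vs vt.
- by rewrite size_map (leq_ltn_trans r0 rX).
- move=> e f /and4P[/and3P[_ e2 _] /and3P[_ f2 _] _ /andP[_]].
  by move: e2 f2; rewrite !inE => /eqP-> /eqP->; rewrite eqxx.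
by exists H; split=> //; apply: Or42; rewrite oH size_map; split=> //; apply/(leq_trans (ltnW rX))/leq_addr.
Qed.

(** Paths have at most [r] vertices, so [r] by [r] matrices record the adjacency between two of
    them. Ramsey is asked for [r + r] paths because the off-diagonal case needs two beyond the first
    [r]. *)
Lemma high_degree_unavoidable r : 2 < r -> exists D, forall G : sgraph, two_connected G ->
  forall v : G, D < #|[set x | adj v x]| -> unavoidable r G.
Proof.
move=> r2; have [M MP] := ramsey {ffun 'I_r * 'I_r -> bool} (r + r).
exists (\sum_(i < r) M ^ i) => G [_ _ G2] v degv.
pose H := induced [set~ v]; pose S := [set y : H | adj v (val y)].
have conn : connected H := G2 v.
have SE : #|[set x | adj v x]| = #|S|.
  rewrite -(card_imset _ (@val_inj _ _ H)); apply: eq_card => x; rewrite inE.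
  apply/idP/imsetP => [vx|[y]]; last by rewrite inE => vy ->.
  have xv : x \in [set~ v] by rewrite !inE; apply: contraTneq vx => ->; rewrite adj_irrefl.
  by exists (exist _ x xv); rewrite ?inE.
rewrite SE in degv; have [[s [t []]]|[w [ps [ltps legs dis]]]] := bfs_star conn degv.
  rewrite !inE => vs vt far; apply: (fan_unavoidable conn vs vt far); lia.
(* The length tests keep the default [w] of [nth] from creating false adjacencies. *)
pose col (p q : seq H) : {ffun 'I_r * 'I_r -> bool} := [ffun ab : 'I_r * 'I_r =>
  [&& ab.1 < size p, ab.2 < size q & adj (nth w p ab.1) (nth w q ab.2)]].
have [c [t [sub_t size_t /(pairwiseP [::]) pt]]] := MP _ col _ (ltnW ltps).
have {dis} /(pairwiseP [::]) dis := subseq_pairwise sub_t dis.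
pose p i := nth [::] t i; rewrite size_t in pt dis.
have legs_p i : i < r + r -> leg w S (p i) /\ 0 < size (p i) <= r.
  by move=> lti; apply: legs; apply: (mem_subseq sub_t); rewrite mem_nth ?size_t.
have disj i j x : i < r + r -> j < r + r -> x \in p i -> x \in p j -> i = j.
  move=> lti ltj xi xj; case: (ltngtP i j) => // ij.
    by have /pred0P/(_ x) := dis _ _ lti ltj ij; rewrite /= xi xj.
  by have /pred0P/(_ x) := dis _ _ ltj lti ij; rewrite /= xi xj.
have colE i j (a b : 'I_r) : i < j < r + r ->
    c (a, b) = [&& a < size (p i), b < size (p j) & adj (nth w (p i) a) (nth w (p j) b)].
  move=> /andP[ij ltj]; have /eqP <- := pt _ _ (ltn_trans ij ltj) ltj ij.
  by rewrite ffunE.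
have ltr (i : 'I_r) : i < r + r by apply: ltn_addr.
case: (pickP (fun a => c (a, a))) => [a caa|nodiag].
  have adj_a (i j : 'I_r) : i < j -> adj (nth w (p i) a) (nth w (p j) a).
    move=> ij; move: caa; rewrite (colE i j) ?ij ?ltr //.
    by case/and3P.
  have mono_a (i j : 'I_r) : adj (nth w (p i) a) (nth w (p j) a) = (i != j).
    case: (ltngtP i j) => [ij|ji|/val_inj->]; last by rewrite adj_irrefl eqxx.
      by rewrite adj_a // -val_eqE neq_ltn ij.
    by rewrite adj_sym adj_a // -val_eqE neq_ltn ji orbT.
  exists (complete r); split; last by apply: Or41; apply: isomorphic_refl.
  apply: (@has_induced_embedding _ (complete r) (fun i => val (nth w (p i) a))).
    move=> i j /val_inj Eij; apply/eqP; apply: contraTT isT => ij.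
    by have := mono_a i j; rewrite Eij adj_irrefl ij.
  exact: mono_a.
apply: unavoidable_theta.
(* For an entry [(a, b)], the vertices at index [a] of the first [r] paths are joined to those at
   index [b] of paths [r] and [r.+1]. The latter two are the hubs, and nothing is subdivided. *)
case: (pickP (fun ab => c ab)) => [[a b] cab|none].
  have cabE i j : i < j < r + r ->
      [/\ a < size (p i), b < size (p j) & adj (nth w (p i) a) (nth w (p j) b)].
    by move=> ij; move: cab; rewrite (colE i j) // => /and3P.
  have r0 : 0 < r + r by lia.
  have hub k : 0 < k < r + r -> nth w (p k) b \in p k.
    by move=> ltk; apply: mem_nth; case: (cabE 0 k).
  have arm (i : 'I_r) : nth w (p i) a \in p i.
    apply: mem_nth; case: (cabE i r) => //; have := ltn_ord i; lia.
  have hub_arm k (i : 'I_r) : r <= k < r + r -> nth w (p i) a != nth w (p k) b.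
    move=> /andP[rk ltk]; apply/eqP => E.
    have ik : i = k :> nat.
      by apply: (disj _ _ _ (ltr i) ltk (arm i)); rewrite E hub //; lia.
    by have := ltn_ord i; rewrite ik ltnNge rk.
  apply: (@theta_has_induced G r (val (nth w (p r) b)) (val (nth w (p r.+1) b))
    (fun=> 0) (fun i _ => val (nth w (p i) a))).
  - rewrite (inj_eq val_inj); apply/eqP => E.
    suff : r = r.+1 by lia.
    by apply: (disj _ _ (nth w (p r) b)); [lia|lia|apply: hub; lia|rewrite E; apply: hub; lia].
  - move=> i j k k'; rewrite !leqn0 => /eqP-> /eqP-> /val_inj E; split=> //.
    by apply/val_inj/(disj _ _ _ (ltr i) (ltr j) (arm i)); rewrite E arm.
  - move=> i j k k'; rewrite !leqn0 => /eqP-> /eqP->; rewrite andbF.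
    (* A false [c (a, a)] means non-adjacency only once [a] is known to be within both paths; [cabE]
       provides that, with path [r] as the later partner of [j']. *)
    have nadj (i' j' : 'I_r) : i' < j' -> adj (nth w (p i') a) (nth w (p j') a) = false.
      move=> ij; have := nodiag a; rewrite (colE i' j') ?ij ?ltr //.
      have [-> _ _] := cabE i' j' ltac:(by rewrite ij ltr).
      by case: (cabE j' r) => [|-> _ _ //]; have := ltn_ord j'; lia.
    case: (ltngtP i j) => [ij|ji|/val_inj->]; [exact: nadj| |exact: adj_irrefl].
    by rewrite adj_sym; apply: nadj.
  - by move=> i _ _; rewrite (inj_eq val_inj) hub_arm //; lia.
  - by move=> i _ _; rewrite (inj_eq val_inj) hub_arm //; lia.
  - move=> i k; rewrite leqn0 => /eqP->; rewrite adj_sym eqxx.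
    by case: (cabE i r) => //; have := ltn_ord i; lia.
  move=> i k; rewrite leqn0 => /eqP->; rewrite adj_sym eqxx.
  by case: (cabE i r.+1) => //; have := ltn_ord i; lia.
(* With the empty pattern, the first [r] legs are the interiors of the paths from [v] to [w]: index
   0 is the one in [S], that is, next to [v], and the last index is the one next to [w]. *)
have lt_p (i : 'I_r) a : a <= (size (p i)).-1 -> a < size (p i).
  by have [_] := legs_p i (ltr i); lia.
apply: (@theta_has_induced G r v (val w) (fun i => (size (p i)).-1)
    (fun i a => val (nth w (p i) a))).
- by have := valP w; rewrite !inE eq_sym.
- move=> i j a b /lt_p lta /lt_p ltb /val_inj E.
  have ij : i = j.
    by apply/val_inj/(disj _ _ _ (ltr i) (ltr j) (mem_nth w lta)); rewrite E mem_nth.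
  subst j; split=> //; have [[up _ _ _ _] _] := legs_p i (ltr i).
  by apply/eqP; rewrite -(nth_uniq w lta ltb up) E.
- move=> i j a b /lt_p lta /lt_p ltb.
  have nadj (i' j' : 'I_r) a' b' : a' < size (p i') -> b' < size (p j') -> i' < j' ->
      adj (nth w (p i') a') (nth w (p j') b') = false.
    move=> lta' ltb' ij.
    have [_ /andP[_ lei]] := legs_p i' (ltr i'); have [_ /andP[_ lej]] := legs_p j' (ltr j').
    have := none (Ordinal (leq_trans lta' lei), Ordinal (leq_trans ltb' lej)).
    by rewrite (colE i' j') ?ij ?ltr //= lta' ltb'.
  have [Eij|nij] := eqVneq i j.
    by subst j; have [[_ _ _ _ adj_p] _] := legs_p i (ltr i); apply: adj_p.
  move: nij; rewrite -val_eqE neq_ltn => /orP[ij|ji]; first exact: nadj.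
  by rewrite adj_sym; apply: nadj.
- by move=> i a _; have := valP (nth w (p i) a); rewrite !inE.
- move=> i a /lt_p lta; rewrite (inj_eq val_inj).
  have [[_ _ _ nw _] _] := legs_p i (ltr i).
  by apply: contraNneq nw => <-; apply: mem_nth.
- move=> i a /lt_p lta; have [[_ inS _ _ _] _] := legs_p i (ltr i).
  by rewrite -inS // inE.
move=> i a /lt_p lta; have [[_ _ adj_w _ _] _] := legs_p i (ltr i).
by rewrite -[LHS]/(adj w (nth w (p i) a)) adj_w //; case: (size (p i)) lta.
Qed.

Theorem theorem1p4 (r : nat) (hr : 2 < r) :
  exists N : nat, forall G : sgraph, two_connected G -> N <= graph_order G ->
    exists H : sgraph, has_induced G H /\
      [\/ isomorphic H (complete r),
          clean_ladder H /\ r <= graph_order H,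
          family_K2 r H
        | family_K2_plus r H].
Proof.
have [D DP] := high_degree_unavoidable hr.
exists (\sum_(i < r) D ^ i).+1 => G G2 leG; have [_ conn _] := G2.
have ltG : \sum_(i < r) D ^ i < #|[set: G]| by rewrite cardsT.
(* With [S] the whole vertex set, a vertex with many legs has large degree: the last vertices of
   disjoint legs are distinct neighbours of [w]. *)
have [[x [y [_ _ far]]]|[w [ps [ltps legs dis]]]] := bfs_star conn ltG.
  have [H [GH cH oH]] := far_pair_ladder G2 (ltnW hr) far.
  by exists H; split=> //; apply: Or42.
apply: (DP G G2 w); apply: leq_trans ltps _.
have lastE p : p \in ps -> last w p \in p /\ adj w (last w p).
  move=> /legs[[_ _ adj_w _ _] /andP[p0 _]].
  by rewrite -nth_last mem_nth ?adj_w ?prednK //; lia.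
have uniq_last : uniq (map (last w) ps).
  rewrite uniq_pairwise pairwise_map; apply: (@sub_in_pairwise _ [in ps]) dis; last first.
    exact/allP.
  move=> p q pps qps /= /pred0P/(_ (last w p)) /=; have [-> _] := lastE p pps.
  by apply: contraFneq => ->; have [] := lastE q qps.
rewrite -(size_map (last w)) -(card_uniqP uniq_last).
by apply/subset_leq_card/subsetP => x /mapP[p /lastE[_ wp] ->]; rewrite inE.
Qed.
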